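(* Let $\chi_{\mathrm{dbv}}\approx1.59362$ be the unique strictly positive root of $\chi\mapsto 2-\chi-2e^{-\chi}$. For every fixed $\chi>\chi_{\mathrm{dbv}}$, as $n\to\infty$, $$\alpha_n^*(\chi)=\alpha^*(\chi)\pm O(1/n),$$ i.e. $|\alpha_n^*(\chi)-\alpha^*(\chi)|=O(1/n)$, where $$\alpha^*(\chi)=\frac{2-\chi-2e^{-\chi}}{2-2\chi-2e^{-\chi}},\qquad \alpha_n^*(\chi)=\frac{2-\chi-2(1-\chi/n)^n-\chi/n}{2-2\chi-2(1-\chi/n)^n}.$$
   Context: The hidden constant in $O(1/n)$ may depend on $\chi$ but not on $n$. *)

(* Defs.v *)
From mathcomp Require Import all_boot all_order all_algebra.
From mathcomp Require Import all_classical all_reals all_analysis.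
Import Order.TTheory GRing.Theory Num.Theory.
Import numFieldNormedType.Exports.

Set Implicit Arguments.
Unset Strict Implicit.
Unset Printing Implicit Defensive.

Local Open Scope ring_scope.

Definition dbv_fun (R : realType) (x : R) : R := 2 - x - 2 * expR (- x).

Definition alpha_star (R : realType) (chi : R) : R :=
  (2 - chi - 2 * expR (- chi)) / (2 - 2 * chi - 2 * expR (- chi)).

(* For n = 0, and for chi at which the denominator vanishes, the value is junk
   (x / 0 = 0); the denominator is nonzero for n large at any fixed chi > 0. *)
Definition alpha_star_n (R : realType) (n : nat) (chi : R) : R :=
  (2 - chi - 2 * (1 - chi / n%:R) ^+ n - chi / n%:R) /
  (2 - 2 * chi - 2 * (1 - chi / n%:R) ^+ n).

(* Main.v *)
Require Import Defs.
From mathcomp Require Import all_boot all_order all_algebra.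
From mathcomp Require Import all_classical all_reals all_analysis.
From mathcomp Require Import ring lra.
Import Order.TTheory GRing.Theory Num.Theory.
Import numFieldNormedType.Exports.
Local Open Scope classical_set_scope.
Local Open Scope ring_scope.

(* The root is located by truncating the exponential series; it is unique because
   [dbv_fun] also vanishes at 0 and its derivative is injective. As
   [0 <= e^-chi - (1 - chi/n)^n <= chi^2/n], the numerators and denominators of
   [alpha_star_n] and [alpha_star] differ by O(1/n), and for [chi > 1.5] both
   denominators are at most -1, so the quotients differ by O(1/n) as well. *)

Lemma exp_coeff0 (R : realType) (x : R) : exp_coeff x 0 = 1.
Proof. by rewrite /exp_coeff /= expr0 fact0 divr1. Qed.

Lemma exp_coeffS (R : realType) (x : R) (n : nat) :
  exp_coeff x n.+1 = exp_coeff x n * (x / n.+1%:R).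
Proof. by rewrite /exp_coeff /= exprSr factS natrM invfM; ring. Qed.

Lemma series_exp_coeff_le_expR (R : realType) (x : R) (n : nat) :
  0 <= x -> series (exp_coeff x) n <= expR x.
Proof.
move=> x0; apply: nondecreasing_cvgn_le; last exact: is_cvg_series_exp_coeff.
apply/nondecreasing_seqP => k; rewrite seriesSr lerDl.
by rewrite divr_ge0 ?exprn_ge0.
Qed.

(* The tail past rank n is at most x^n / n! times the whole series, since
   n! k! <= (n + k)!. *)
Lemma expR_le_series_exp_coeff (R : realType) (x : R) (n : nat) : 0 <= x ->
  expR x <= series (exp_coeff x) n + exp_coeff x n * expR x.
Proof.
move=> x0; rewrite {1}/expR.
have coeff_ge0 k : 0 <= exp_coeff x k by rewrite divr_ge0 ?exprn_ge0.
apply: limr_le; first exact: is_cvg_series_exp_coeff.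
exists n => // m /= nm; rewrite -(subnKC nm); set k := (m - n)%N.
rewrite /series /= (@big_cat_nat _ _ _ n) ?leq_addr //= lerD2l.
apply: (@le_trans _ _ (exp_coeff x n * series (exp_coeff x) k)); last first.
  by rewrite ler_wpM2l // series_exp_coeff_le_expR.
rewrite /series /= -{1}[n]add0n big_addn addKn mulr_sumr.
apply: ler_sum => i _; rewrite /exp_coeff /= addnC exprD mulrACA.
rewrite ler_wpM2l ?mulr_ge0 ?exprn_ge0 // -invfM.
rewrite lef_pV2 ?posrE ?mulr_gt0 ?ltr0n ?fact_gt0 // -natrM ler_nat.
by rewrite -(bin_fact (leq_addr i n)) addKn leq_pmull // bin_gt0 leq_addr.
Qed.

Lemma is_derive_dbv_fun (R : realType) (x : R) :
  is_derive x 1 (@dbv_fun R) (2 * expR (- x) - 1).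
Proof.
rewrite /dbv_fun.
apply: is_derive_eq.
rewrite /GRing.scale /=; ring.
Qed.

Lemma continuous_dbv_fun (R : realType) : continuous (@dbv_fun R).
Proof.
move=> x; apply/differentiable_continuous/derivable1_diffP.
by have [] := is_derive_dbv_fun R x.
Qed.

(* Two positive roots, together with the root 0, would by Rolle give two
   distinct zeros of the injective derivative. *)
Lemma dbv_fun_root_uniq (R : realType) (a b : R) :
  0 < a -> a < b -> dbv_fun a = 0 -> dbv_fun b = 0 -> False.
Proof.
move=> a0 ab fa fb.
have f0 : dbv_fun (0 : R) = 0 by rewrite /dbv_fun oppr0 expR0; ring.
have zero (u v : R) : u < v -> dbv_fun u = dbv_fun v ->
    exists2 c, u < c < v & 2 * expR (- c) = 1.
  move=> uv fuv; have [||c cuv dc] := @Rolle R (@dbv_fun R) u v uv _ _ fuv.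
  - by move=> x _; have [] := is_derive_dbv_fun R x.
  - exact/continuous_subspaceT/continuous_dbv_fun.
  exists c; first by move: cuv; rewrite in_itv.
  have := @derive_val _ _ _ _ _ _ _ dc.
  by rewrite (@derive_val _ _ _ _ _ _ _ (is_derive_dbv_fun R c)); lra.
have [c /andP[_ ca] dc] := zero _ _ a0 (etrans f0 (esym fa)).
have [d /andP[ad _] dd] := zero _ _ ab (etrans fa (esym fb)).
have /expR_inj : expR (- c) = expR (- d) by lra.
lra.
Qed.

(** Horner form, free of factorials and high powers, so that [lra] can evaluate the sum at a
    rational point. *)
Lemma series_exp_coeff12 (R : realType) (x : R) : series (exp_coeff x) 12%N =
  1 + x * (1 + x / 2 * (1 + x / 3 * (1 + x / 4 * (1 + x / 5 * (1 + x / 6 *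
  (1 + x / 7 * (1 + x / 8 * (1 + x / 9 * (1 + x / 10 * (1 + x / 11)))))))))).
Proof.
rewrite !seriesSr [series _ _]big_geq // !(exp_coeffS, exp_coeff0).
by field; rewrite ?pnatr_eq0.
Qed.

Lemma exp_coeff12 (R : realType) (x : R) : exp_coeff x 12%N =
  x * (x / 2) * (x / 3) * (x / 4) * (x / 5) * (x / 6) * (x / 7) * (x / 8) *
  (x / 9) * (x / 10) * (x / 11) * (x / 12).
Proof. by rewrite !(exp_coeffS, exp_coeff0); field; rewrite ?pnatr_eq0. Qed.

(* The interval with end points 1.59362 and 1.593625 contains the root
   1.5936242...; twelve terms of the exponential series suffice to tell. *)
Lemma dbv_fun_bracket (R : realType) :
  0 <= dbv_fun (1 + 59 / 10 ^+ 2 + 362 / 10 ^+ 5 : R) /\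
  dbv_fun (1 + 59 / 10 ^+ 2 + 3625 / 10 ^+ 6 : R) <= 0.
Proof.
rewrite /dbv_fun !expRN; split.
  set a : R := (X in 2 - X - _).
  have a0 : 0 <= a by rewrite /a; lra.
  (* Nonnegativity of [dbv_fun a], restated. Multiplied by [expR a] it is linear in [expR a], and
     the partial sum bounds [expR a] from below. *)
  have inv_le : (expR a)^-1 <= (2 - a) / 2.
    rewrite -[leLHS]mul1r ler_pdivrMr ?expR_gt0 //.
    move: (expR a) (series_exp_coeff_le_expR R a 12 a0) => e.
    by rewrite series_exp_coeff12 /a => le_e; lra.
  by move: ((expR a)^-1) inv_le => e; lra.
set b : R := (X in 2 - X - _).
have b0 : 0 <= b by rewrite /b; lra.
(* This needs an upper bound on [expR b]. The tail estimate has [expR b] on both sides, but it is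
   linear in it, with a coefficient below 1 on the right. *)
have inv_ge : (2 - b) / 2 <= (expR b)^-1.
  rewrite -[leRHS]mul1r ler_pdivlMr ?expR_gt0 //.
  move: (expR b) (expR_le_series_exp_coeff R b 12 b0) => e.
  by rewrite series_exp_coeff12 exp_coeff12 /b => le_e; lra.
by move: ((expR b)^-1) inv_ge => e; lra.
Qed.

(** The power map is [n]-Lipschitz on the unit interval: each induction step adds at most one
    [a - b], since [a] and [b ^+ n] are at most 1. *)
Lemma ler_subX_mulrn (R : realDomainType) (a b : R) (n : nat) :
  0 <= b -> b <= a -> a <= 1 -> a ^+ n - b ^+ n <= n%:R * (a - b).
Proof.
move=> b0 ba a1; elim: n => [|n IH]; first by rewrite !expr0 subrr mul0r.
have a0 : 0 <= a by exact: le_trans ba.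
have -> : a ^+ n.+1 - b ^+ n.+1 = a * (a ^+ n - b ^+ n) + b ^+ n * (a - b).
  by rewrite !exprS; ring.
rewrite -natr1 mulrDl; apply: lerD.
  apply: le_trans IH; rewrite ler_piMl // subr_ge0.
  by rewrite lerXn2r ?nnegrE.
by rewrite ler_wpM2r ?subr_ge0 ?exprn_ile1 // (le_trans ba).
Qed.

(** With [u = x / n], both terms are [n]-th powers, of [expR (- u)] and [1 - u]. These bases differ
    by at most [u ^+ 2], and the Lipschitz bound gives [n * u ^+ 2]. *)
Lemma expRN_sub_expr_le (R : realType) (x : R) (n : nat) : (0 < n)%N ->
  0 <= x -> x <= n%:R ->
  0 <= expR (- x) - (1 - x / n%:R) ^+ n <= x ^+ 2 / n%:R.
Proof.
move=> n0 x0 xn; set u := x / n%:R.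
have nR0 : 0 < n%:R :> R by rewrite ltr0n.
have u0 : 0 <= u by rewrite divr_ge0.
have u1 : u <= 1 by rewrite ler_pdivrMr ?mul1r.
have -> : expR (- x) = expR (- u) ^+ n.
  by rewrite -expRM_natl mulrN /u mulrCA divff ?mulr1 // gt_eqF.
have b0 : 0 <= 1 - u by lra.
have ba : 1 - u <= expR (- u) by have := expR_ge1Dx (- u).
have a1 : expR (- u) <= 1 by rewrite expR_le1 oppr_le0.
apply/andP; split; first by rewrite subr_ge0 lerXn2r ?nnegrE ?expR_ge0.
apply: le_trans (ler_subX_mulrn _ _ _ _ b0 ba a1) _.
have -> : x ^+ 2 / n%:R = n%:R * u ^+ 2 by rewrite /u; field; rewrite gt_eqF.
rewrite ler_wpM2l // ?ler0n //.
have : expR (- u) <= (1 + u)^-1.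
  rewrite expRN lef_pV2 ?posrE ?expR_gt0 //; first exact: expR_ge1Dx.
  lra.
(* Holds because [(1 + u) * (1 - u + u ^+ 2) = 1 + u ^+ 3]. *)
have : (1 + u)^-1 <= 1 - u + u ^+ 2.
  rewrite -[leLHS]mul1r ler_pdivrMr; last lra.
  by rewrite expr2; nra.
lra.
Qed.

Lemma alpha_star_n_rate (R : realType) (x : R) (n : nat) :
  1 + 2^-1 <= x -> x <= n%:R ->
  `|alpha_star_n n x - alpha_star x| <=
    (6 * x ^+ 3 + 2 * x ^+ 2) / n%:R.
Proof.
move=> x1 xn; have x0 : 0 <= x by lra.
have nR0 : 0 < n%:R :> R by lra.
have n0 : (0 < n)%N by rewrite -(ltr0n R).
have /andP[] := expRN_sub_expr_le R x n n0 x0 xn.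
rewrite /alpha_star_n /alpha_star.
have : 0 <= (1 - x / n%:R) ^+ n.
  by rewrite exprn_ge0 // subr_ge0 ler_pdivrMr ?mul1r.
have : 1 - x <= expR (- x) := expR_ge1Dx (- x).
have : expR (- x) <= 1 by rewrite expR_le1 oppr_le0.
move: (expR _) ((1 - _) ^+ n) => q p q1 qx p0 qp0 qp.
set h := x / n%:R; set e := x ^+ 2 / n%:R in qp.
have h0 : 0 <= h by rewrite divr_ge0.
set Dn := 2 - 2 * x - 2 * p; set D := 2 - 2 * x - 2 * q; set N := 2 - x - 2 * q.
have Dn1 : Dn <= -1 by rewrite /Dn; lra.
have D1 : D <= -1 by rewrite /D; lra.
(* The first numerator is [N + 2 * (q - p) - h] and [Dn = D + 2 * (q - p)], so [N * D] cancels in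
   the cross product. *)
have -> : (2 - x - 2 * p - h) / Dn - N / D =
    ((2 * (q - p) - h) * D - N * (2 * (q - p))) / (Dn * D).
  have -> : p = q - (q - p) by ring.
  by rewrite /N /D /Dn; field; rewrite -/D -/Dn; apply/andP; split; lra.
rewrite normrM normfV.
have DnD1 : 1 <= `|Dn * D| by rewrite ger0_norm; nra.
apply: (@le_trans _ _ `|(2 * (q - p) - h) * D - N * (2 * (q - p))|).
  by rewrite ler_piMr // invf_le1 // (lt_le_trans ltr01).
(* The factors come from [0 <= q - p <= e], [|D| <= 2 * x] and [|N| <= x]; the last uses
   [1 - x <= q <= 1]. *)
have -> : (6 * x ^+ 3 + 2 * x ^+ 2) / n%:R =
    (2 * e + h) * (2 * x) + x * (2 * e).
  by rewrite /e /h; ring.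
apply: le_trans (ler_normB _ _) _; rewrite !normrM.
apply: lerD; apply: ler_pM => //; rewrite -?normrM ler_norml; apply/andP; split;
  rewrite /D /N; lra.
Qed.

Theorem corollary4 (R : realType) :
  exists chi_dbv : R,
    [/\ unique (fun x : R => 0 < x /\ dbv_fun x = 0) chi_dbv,
        `|chi_dbv - (1 + 59 / 10 ^+ 2 + 362 / 10 ^+ 5)| <= 5 / 10 ^+ 6
      & forall chi : R, chi_dbv < chi ->
          (fun n : nat => `|alpha_star_n n chi - alpha_star chi|)
            =O_\oo (fun n : nat => n%:R^-1 : R)].
Proof.
have [fa fb] := dbv_fun_bracket R.
have [|||x /[!in_itv] /= /andP[ax xb] fx] :=
  @IVT R (@dbv_fun R) (1 + 59 / 10 ^+ 2 + 362 / 10 ^+ 5)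
    (1 + 59 / 10 ^+ 2 + 3625 / 10 ^+ 6) 0.
- lra.
- exact/continuous_subspaceT/continuous_dbv_fun.
- by rewrite ge_min fb orbT le_max fa.
exists x; split.
- split=> [|y [y0 fy]]; first by split => //; lra.
  have x0 : 0 < x by lra.
  by case: (ltgtP x y) => // h; [have := dbv_fun_root_uniq _ _ _ x0 h fx fy
                               | have := dbv_fun_root_uniq _ _ _ y0 h fy fx].
(* The bracket has length exactly [5 / 10 ^+ 6]. *)
- by rewrite ler_norml; apply/andP; split; lra.
move=> chi xchi; apply/eqO_exP.
have chi_ge : 1 + 2^-1 <= chi by lra.
have chi_gt0 : 0 < chi by lra.
exists (6 * chi ^+ 3 + 2 * chi ^+ 2).
  by rewrite addr_gt0 // mulr_gt0 // exprn_gt0.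
near=> n; rewrite normr_id [`|n%:R^-1|]ger0_norm ?invr_ge0 ?ler0n //.
apply: alpha_star_n_rate => //.
(* Eventually [chi <= n], which keeps the base [1 - chi / n] nonnegative. *)
near: n; exact: nbhs_infty_ger.
Unshelve. all: by end_near. Qed.
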